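(* Let $n\ge 2$, let $\mathscr{C}_H\subseteq\mathbb{F}_2^{2^n-1}$ be the $[2^n-1,\,2^n-1-n,\,3]$ Hamming code, and let $G_3$ be the graph with vertex set $\mathscr{C}_H$ in which two codewords are adjacent if and only if their Hamming distance is exactly $3$. Then $G_3$ is connected.
   Context: The $[2^n-1,\,2^n-1-n,\,3]$ Hamming code is the kernel over $\mathbb{F}_2$ of an $n\times(2^n-1)$ matrix whose columns are all the nonzero vectors of $\mathbb{F}_2^n$, each appearing once. *)

(* Defs.v *)
From mathcomp Require Import all_boot all_order all_algebra.

Set Implicit Arguments.
Unset Strict Implicit.
Unset Printing Implicit Defensive.

Import GRing.Theory.
Local Open Scope ring_scope.

Definition hamming_check_matrix (n : nat) (H : 'M['F_2]_(n, 2 ^ n - 1)) : Prop :=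
  (forall j, col j H != 0) /\
  (forall v : 'cV['F_2]_n, v != 0 -> exists! j, col j H = v).

(* Words are column vectors. *)
Definition kernel_code (m N : nat) (H : 'M['F_2]_(m, N)) : {set 'cV['F_2]_N} :=
  [set x | H *m x == 0].

Definition hamming_dist (N : nat) (x y : 'cV['F_2]_N) : nat :=
  #|[set i | x i 0 != y i 0]|.

Definition dist_adj (N : nat) (C : {set 'cV['F_2]_N}) (d : nat) :
    rel {x : 'cV['F_2]_N | x \in C} :=
  fun x y => hamming_dist (val x) (val y) == d.

Lemma dist_adj_sym (N : nat) (C : {set 'cV['F_2]_N}) (d : nat) :
  symmetric (@dist_adj N C d).
Proof.
move=> x y; rewrite /dist_adj /hamming_dist; congr (_ == _).
by apply: eq_card => i; rewrite !inE eq_sym.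
Qed.

Lemma dist_adj_irrefl (N : nat) (C : {set 'cV['F_2]_N}) (d : nat) :
  (0 < d)%N -> irreflexive (@dist_adj N C d).
Proof.
move=> d_gt0 x; rewrite /dist_adj /hamming_dist eq_card0 ?ltn_eqF //.
by move=> i; rewrite !inE eqxx.
Qed.

(* For a symmetric relation; the empty graph does not count as connected. *)
Definition connected_graph (V : finType) (e : rel V) : Prop :=
  (0 < #|V|)%N /\ forall x y : V, connect e x y.

(* Main.v *)
Require Import Defs.
From mathcomp Require Import all_boot all_order all_algebra.

(** If two codewords differ at distinct positions [i] and [j], let [k] be the
    position of the column [h_i + h_j].  Flipping the bits [i], [j], [k] of the
    first codeword is an edge of the graph, and it decreases the distance to the
    second one: two differences disappear and at most one, at [k], is created. *)

Set Implicit Arguments.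
Unset Strict Implicit.
Unset Printing Implicit Defensive.

Import GRing.Theory.
Local Open Scope ring_scope.

Lemma F2_cases (a : 'F_2) : a = 0 \/ a = 1.
Proof. by case: a => [[|[|//]] lt_a2]; [left|right]; apply: val_inj. Qed.

Lemma F2_neq_add1 (a b : 'F_2) : a != b -> a + 1 = b.
Proof.
by case: (F2_cases a) => ->; case: (F2_cases b) => -> // _; apply: val_inj.
Qed.

Lemma F2_addrr (a : 'F_2) : a + a = 0.
Proof. by case: (F2_cases a) => ->; apply: val_inj. Qed.

Lemma F2_mx_addrr (m n : nat) (A : 'M['F_2]_(m, n)) : A + A = 0.
Proof. by apply/matrixP => i j; rewrite !mxE F2_addrr. Qed.

Section FlipThree.

Variables (N : nat) (i j k : 'I_N).
Hypotheses (ij : i != j) (ik : i != k) (jk : j != k).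

Definition flip3 (x : 'cV['F_2]_N) : 'cV['F_2]_N :=
  x + (delta_mx i 0 + delta_mx j 0 + delta_mx k 0).

(** Since [i], [j], [k] are distinct, the three unit vectors have disjoint supports and no two of
    them cancel. *)
Lemma flip3E x l : flip3 x l 0 = x l 0 + (l \in [set i; j; k])%:R.
Proof.
rewrite !mxE !andbT !inE.
have [->|_] := eqVneq l i; first by rewrite (negPf ij) (negPf ik) !addr0.
have [->|_] := eqVneq l j; first by rewrite (negPf jk) add0r addr0.
by rewrite !add0r.
Qed.

Lemma hamming_dist_flip3 x : hamming_dist x (flip3 x) = 3.
Proof.
rewrite /hamming_dist (_ : [set _ | _] = [set i; j; k]).
  rewrite setUC cardsU1 cards2 !inE ij.
  by rewrite negb_or eq_sym ik eq_sym jk.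
apply/setP => l; rewrite inE flip3E eq_sym -subr_eq0 [x l 0 + _]addrC addrK.
by case: (l \in _); rewrite ?oner_eq0 ?eqxx.
Qed.

Lemma hamming_dist_flip3_lt (x y : 'cV['F_2]_N) :
  x i 0 != y i 0 -> x j 0 != y j 0 ->
  (hamming_dist (flip3 x) y < hamming_dist x y)%N.
Proof.
move=> xyi xyj; rewrite /hamming_dist; set D := [set l | x l 0 != y l 0].
have iD : i \in D by rewrite inE.
have jD : j \in D :\ i by rewrite !inE eq_sym ij.
rewrite (cardsD1 i D) iD (cardsD1 j (D :\ i)) jD !add1n ltnS.
(* After the flip the words agree at [i] and [j], and outside the triple nothing changes. Whether
   they differ at [k] is left open: adding [k] costs at most one. *)
apply: leq_trans (_ : #|k |: (D :\ i :\ j)| <= _)%N.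
  apply/subset_leq_card/subsetP => l; rewrite inE flip3E !inE.
  have [->|_] := eqVneq l i; first by rewrite (F2_neq_add1 xyi) eqxx.
  have [->|_] := eqVneq l j; first by rewrite (F2_neq_add1 xyj) eqxx.
  by case: (l == k); rewrite ?addr0.
by rewrite cardsU1 -add1n leq_add2r leq_b1.
Qed.

(** The syndrome changes by the sum of the three columns, which is twice [col i H + col j H], hence
    zero. *)
Lemma flip3_kernel_code (m : nat) (H : 'M['F_2]_(m, N)) x :
  col k H = col i H + col j H -> x \in kernel_code H ->
  flip3 x \in kernel_code H.
Proof.
move=> colk; rewrite !inE => /eqP Hx.
by rewrite !mulmxDr -!colE Hx add0r colk F2_mx_addrr.
Qed.

End FlipThree.

(** If [i] were the only difference, [y] would be [x] plus a unit vector, and applying [H] would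
    give [col i H = 0]. *)
Lemma kernel_code_differ_again (m N : nat) (H : 'M['F_2]_(m, N))
    (x y : 'cV['F_2]_N) (i : 'I_N) :
  (forall j, col j H != 0) -> x \in kernel_code H -> y \in kernel_code H ->
  x i 0 != y i 0 -> exists2 j, i != j & x j 0 != y j 0.
Proof.
move=> col_neq0; rewrite !inE => /eqP Hx /eqP Hy xyi.
have [/existsP[j /andP[ij xyj]]|/existsPn noj] :=
  boolP [exists j, (i != j) && (x j 0 != y j 0)]; first by exists j.
have yE : y = x + delta_mx i 0.
  apply/matrixP => l o; rewrite (ord1 o) !mxE andbT.
  have [->|li] := eqVneq l i; first by rewrite (F2_neq_add1 xyi).
  by have := noj l; rewrite eq_sym li negbK addr0 => /eqP->.
move: Hy; rewrite yE mulmxDr Hx add0r -colE => /eqP.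
by rewrite (negPf (col_neq0 i)).
Qed.

Lemma hamming_third_column (n : nat) (H : 'M['F_2]_(n, 2 ^ n - 1))
    (i j : 'I_(2 ^ n - 1)) :
  hamming_check_matrix H -> i != j ->
  exists k, [/\ i != k, j != k & col k H = col i H + col j H].
Proof.
move=> [col_neq0 col_onto] ij.
have ij_neq0 : col i H + col j H != 0.
  apply: contra ij => /eqP hij.
  (* In characteristic 2 a zero sum means that the two columns are equal; uniqueness of the position
     [l] of that column then forces [i = l = j]. *)
  have [l [_ col_inj]] := col_onto _ (col_neq0 i).
  rewrite -(col_inj i) // -(col_inj j) //.
  by rewrite -[LHS]add0r -(F2_mx_addrr (col i H)) -addrA hij addr0.
have [k [colk _]] := col_onto _ ij_neq0; exists k; split=> //.
(* If [k] were [i], cancelling [col i H] would leave [col j H = 0]; the case [k = j] is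
   symmetric. *)
- apply: contraNneq (col_neq0 j) => ik; apply/eqP/(addrI (col i H)).
  by rewrite -colk -ik addr0.
- apply: contraNneq (col_neq0 i) => jk; apply/eqP/(addIr (col j H)).
  by rewrite -colk -jk add0r.
Qed.

Theorem proposition2 (n : nat) (H : 'M['F_2]_(n, 2 ^ n - 1)) :
  (2 <= n)%N -> hamming_check_matrix H ->
  connected_graph (@dist_adj (2 ^ n - 1) (kernel_code H) 3).
Proof.
move=> _ hamH; split.
  have C0 : 0 \in kernel_code H by rewrite inE mulmx0.
  by apply/card_gt0P; exists (exist _ 0 C0).
(* Induction on a strict bound [d] for the distance, with [y] fixed and [x] moving towards it. *)
move=> x y; have [d] := ubnP (hamming_dist (val x) (val y)).
elim: d x => // d IHd x; rewrite ltnS => le_d.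
have [/eqP xy0|] := boolP ([set l | val x l 0 != val y l 0] == set0).
  rewrite (_ : x = y) ?connect0 //; apply/val_inj/matrixP => l o.
  by have /setP/(_ l) := xy0; rewrite !inE (ord1 o) => /negbFE/eqP.
case/set0Pn => i; rewrite inE => xyi.
have [j ij xyj] :=
  kernel_code_differ_again hamH.1 (valP x) (valP y) xyi.
have [k [ik jk colk]] := hamming_third_column hamH ij.
pose z : {z | z \in kernel_code H} :=
  Sub (flip3 i j k (val x)) (flip3_kernel_code colk (valP x)).
apply: (connect_trans (y := z)).
  by apply: connect1; rewrite /dist_adj hamming_dist_flip3.
by apply: IHd; apply: leq_trans le_d; apply: hamming_dist_flip3_lt.
Qed.
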